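(* Let $k$ be a field and let $\mathfrak{F}:\mathbb{P}^n\dashrightarrow\mathbb{P}^m$ be a rational map over $k$, given by $m+1$ forms $\mathbf{f}=\{f_0,\ldots,f_m\}\subset k[X_0,\ldots,X_n]$ of a fixed degree. If the image of $\mathfrak{F}$ has dimension $n$ and the linear part $\phi_1$ of the syzygy matrix of $\mathbf{f}$ has rank $m$ (the maximal possible), then $\mathfrak{F}$ is birational onto its image.
   Context: $k$ is of arbitrary characteristic and $R=k[X_0,\ldots,X_n]$. The forms $f_j$ have the same degree $d\geq 1$ and are not all zero. Let $\phi$ be a graded matrix whose columns generate the first syzygy module of $\mathbf{f}$ (a submodule of $R^{m+1}$). The linear part $\phi_1$ is the matrix whose columns form a set of generators of $\mathrm{Im}(\phi)_{d+1}$, i.e. of the syzygies of $\mathbf{f}$ all of whose coordinates are linear forms of $R$. Ranks are over the fraction field of $R$. The image of $\mathfrak{F}$ is the projective variety with homogeneous coordinate ring $S\simeq k[\mathbf{f}]$ (degrees renormalized). $\mathfrak{F}$ is birational onto its image if there are forms $g_0,\ldots,g_n\in S$ of the same degree such that the tuple $(g_0(\mathbf{f}),\ldots,g_n(\mathbf{f}))$ is nonzero and proportional, over the fraction field of $R$, to $(X_0,\ldots,X_n)$. *)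

(* Defs.v *)
From HB Require Import structures.
From mathcomp Require Import all_boot all_order all_algebra.
From mathcomp Require Import ring_quotient fraction.
From mathcomp Require Import mpoly.

Set Implicit Arguments.
Unset Strict Implicit.
Unset Printing Implicit Defensive.

Import GRing.Theory.
Local Open Scope ring_scope.

Section ProjectiveDimension.
Variables (k : fieldType) (m : nat).
Implicit Types I P : {pred {mpoly k[m.+1]}}.

Definition homogeneous_ideal P : Prop :=
  forall (p : {mpoly k[m.+1]}) (e : nat), p \in P -> pihomog mdeg e p \in P.

(* The points of Proj (k[Y_0, ..., Y_m] / I), i.e. the irreducible closed
   subsets of V_+(I) in P^m, as primes of the polynomial ring containing I.
   [idealr_closed] includes properness. *)
Definition Proj_point I P : Prop :=
  [/\ idealr_closed P, prime_idealr_closed P, homogeneous_ideal P,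
      {subset I <= P} & exists j : 'I_m.+1, 'X_j \notin P].

(* P 0, ..., P r is a strictly increasing chain of length r; the values P i
   with i > r are irrelevant. *)
Definition Proj_chain I (r : nat) (P : nat -> {pred {mpoly k[m.+1]}}) : Prop :=
  (forall i : nat, (i <= r)%N -> Proj_point I (P i)) /\
  (forall i : nat, (i < r)%N ->
     {subset P i <= P i.+1} /\ exists2 p, p \in P i.+1 & p \notin P i).

Definition Proj_dim_eq I (r : nat) : Prop :=
  (exists Q, Proj_chain I r Q) /\
  (forall s Q, Proj_chain I s Q -> (s <= r)%N).

End ProjectiveDimension.

Section RationalMap.
Variables (k : fieldType) (n m : nat).
Local Notation R := {mpoly k[n.+1]}.
Implicit Type f : (m.+1).-tuple R.

(* The kernel of k[Y_0, ..., Y_m] -> k[f], Y_j |-> f_j; the quotient is the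
   homogeneous coordinate ring S of the image. *)
Definition image_ideal f : {pred {mpoly k[m.+1]}} :=
  [pred G : {mpoly k[m.+1]} | G \mPo f == 0].

Definition image_dim_eq f (r : nat) : Prop := Proj_dim_eq (image_ideal f) r.

(* A form of degree e of S is the class of a form G of degree e in
   k[Y_0, ..., Y_m], and its value at f is G \mPo f. *)
Definition birational_onto_image f : Prop :=
  exists (e : nat) (g : 'I_n.+1 -> {mpoly k[m.+1]}),
    [/\ forall i, g i \is e.-homog,
        exists i, g i \mPo f != 0
      & exists c : {fraction R},
          forall i, FracField.tofrac (g i \mPo f) = c * FracField.tofrac 'X_i].

Definition syzygy f (v : 'cV[R]_m.+1) : Prop :=
  \sum_(j < m.+1) tnth f j * v j 0 = 0.

(* Since the f_j have a common degree, gradedness of phi means that the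
   entries of each column are forms of one degree. *)
Definition graded_syzygy_matrix f (p : nat) (phi : 'M[R]_(m.+1, p)) : Prop :=
  (forall l : 'I_p, exists e : nat, forall j, phi j l \is e.-homog) /\
  (forall v : 'cV[R]_m.+1,
     syzygy f v <-> exists u : 'cV[R]_p, v = phi *m u).

(* The columns of phi1 span over k the elements of Im(phi) whose coordinates
   are linear forms. *)
Definition linear_part (p q : nat) (phi : 'M[R]_(m.+1, p))
    (phi1 : 'M[R]_(m.+1, q)) : Prop :=
  forall v : 'cV[R]_m.+1,
    (exists u : 'cV[R]_p, v = phi *m u) /\ (forall j, v j 0 \is 1.-homog) <->
    exists c : 'cV[k]_q, v = phi1 *m map_mx (@mpolyC n.+1 k) c.

Definition frac_rank (p : nat) (A : 'M[R]_(m.+1, p)) : nat :=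
  \rank (map_mx (@FracField.tofrac R) A).

End RationalMap.

(* Main.v *)
Require Import Defs.
From mathcomp Require Import all_boot all_order all_algebra.
From mathcomp Require Import ring_quotient fraction mpoly.
From mathcomp Require Import ring zify.

(** Write Y phi1 = X B(Y), where B is a matrix of linear forms in Y_0, ..., Y_m.
    Then X B(f) = f phi1 = 0, so elimination gives forms g_i of one degree such
    that w = g(f) is nonzero and w B(f) = 0. Substituting X + t w for X, both f
    and f(X + t w) are killed by phi1(X + t w), which has corank 1 because
    phi1 does; hence f(X + t w) is proportional to f: the line through X in the
    direction w is contracted by the map. On the other hand, a chain of n + 1
    homogeneous primes yields n + 1 forms of one degree that are algebraically
    independent modulo the image ideal, and by counting monomials each
    X_i / X_l is algebraic over the degree 0 part of k(f). So (X_i + t w_i) /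
    (X_l + t w_l) is algebraic over k(X), i.e. does not depend on t, and w is
    proportional to X. *)

Set Implicit Arguments.
Unset Strict Implicit.
Unset Printing Implicit Defensive.

Import GRing.Theory.
Local Open Scope ring_scope.

(** * Evaluation and composition of forms *)

Section Evaluation.
Variables (k : comNzRingType) (S : comNzRingType) (c : {rmorphism k -> S}).

Lemma mmap_homogZ n e (G : {mpoly k[n]}) (a : S) (y : 'I_n -> S) :
  G \is e.-homog -> mmap c (fun i => a * y i) G = a ^+ e * mmap c y G.
Proof.
move=> /dhomogP homG; rewrite /mmap mulr_sumr !big_seq.
apply: eq_bigr => mo /homG <-; rewrite mulrCA; congr (_ * _).
rewrite /mmap1 (eq_bigr (fun i => a ^+ mo i * y i ^+ mo i)); last first.
  by move=> i _; rewrite exprMn.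
by rewrite big_split /= prodrXr mdegE.
Qed.

Lemma eq_mmap n (y z : 'I_n -> S) :
  y =1 z -> mmap c y =1 mmap c z.
Proof. by move=> yz G; apply: eq_bigr => mo _; rewrite (mmap1_eq _ yz). Qed.

Lemma mmap_comp_mpoly n m (f : m.-tuple {mpoly k[n]}) (y : 'I_n -> S) G :
  mmap c y (G \mPo f) = mmap c (fun j => mmap c y (tnth f j)) G.
Proof.
rewrite comp_mpolyE raddf_sum; apply: eq_bigr => mo _ /=.
rewrite mmapZ rmorph_prod; congr (_ * _).
by apply: eq_bigr => i _; rewrite rmorphXn.
Qed.

End Evaluation.

Lemma homog1E (k : nzRingType) n (G : {mpoly k[n]}) :
  G \is 1.-homog -> G = \sum_i G@_U_(i) *: 'X_i.
Proof.
move=> homG; apply/mpolyP => mo; rewrite raddf_sum /=.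
have [/mdeg1P[i /eqP->]|mo1] := boolP (mdeg mo == 1)%N.
  rewrite (bigD1 i) //= big1 => [|l li]; rewrite mcoeffZ mcoeffX ?eqxx.
    by rewrite mulr1 addr0.
  case: eqP => [/mnmP/(_ i)|_]; last by rewrite mulr0.
  by rewrite !mnm1E eqxx (negPf li).
rewrite (dhomog_nemf_coeff homG mo1) big1 // => i _.
rewrite mcoeffZ mcoeffX; case: eqP => [mU|_]; last by rewrite mulr0.
by rewrite -mU mdeg1 eqxx in mo1.
Qed.

Lemma homog_prod_const (k : nzRingType) n d r (h : 'I_r -> {mpoly k[n]})
    (E : 'I_r -> nat) :
  (forall i, h i \is d.-homog) ->
  \prod_i h i ^+ E i \is (d * \sum_i E i).-homog.
Proof.
move=> homh; rewrite big_distrr /=.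
elim/big_rec2: _ => [|i y1 y2 _ IH]; first exact: dhomog1.
by apply: dhomogM => //; apply: dhomogMn.
Qed.

Lemma comp_mpoly_homog (k : comNzRingType) n m d e (f : m.-tuple {mpoly k[n]})
    (G : {mpoly k[m]}) :
  (forall j, tnth f j \is d.-homog) -> G \is e.-homog ->
  G \mPo f \is (d * e).-homog.
Proof.
move=> homf /dhomogP homG; rewrite comp_mpolyE big_seq.
apply: rpred_sum => mo /homG <-; apply: rpredZ.
by have := homog_prod_const (fun i => mo i) homf; rewrite -mdegE.
Qed.

(** * Kernel vectors whose entries are values of forms *)

Section Elimination.
Variables (k : comNzRingType) (m : nat) (D : idomainType).
Variable (phi : {rmorphism {mpoly k[m]} -> D}).
Variables (I J : finType).

(* Fraction-free Gaussian elimination: the witness stays among the forms. *)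
Lemma homog_left_kernel (A : {set I}) d (M : I -> J -> {mpoly k[m]})
    (x : I -> D) :
  (forall i l, M i l \is d.-homog) ->
  (forall l, \sum_(i in A) x i * phi (M i l) = 0) ->
  (exists2 i, i \in A & x i != 0) ->
  exists (e : nat) (g : I -> {mpoly k[m]}),
    [/\ forall i, g i \is e.-homog,
        exists2 i, i \in A & phi (g i) != 0
      & forall l, \sum_(i in A) phi (g i) * phi (M i l) = 0].
Proof.
have [s] := ubnP #|A|; elim: s A d M x => // s IH A d M x; rewrite ltnS => leAs.
move=> homM xM0 [i0 i0A xi0].
(* If no pivot is left, all relations on [A] are trivial and the constant tuple 1 is a solution. *)
have [/forall_inP M0|] := boolP [forall i in A, forall l, phi (M i l) == 0].
  exists 0%N, (fun=> 1); split=> [i||l]; first exact: dhomog1.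
    by exists i0; rewrite // rmorph1 oner_eq0.
  by apply: big1 => i /M0/forallP/(_ l)/eqP->; rewrite mulr0.
case/forall_inPn => i iA /forallPn[j] a0.
pose a := M i j; pose A' := A :\ i.
(* The pivot [a] removes the unknown [i]. The cross-multiplied entries are again forms of one
   degree, now [d + d]. *)
pose M' t l : {mpoly k[m]} := a * M t l - M t j * M i l.
have sumA (F : I -> D) : \sum_(t in A) F t = F i + \sum_(t in A') F t.
  by rewrite (bigD1 i) //=; congr (_ + _); apply: eq_bigl => t;
     rewrite !inE andbC.
have xi : phi a * x i = - \sum_(t in A') x t * phi (M t j).
  by apply/eqP; rewrite -addr_eq0 mulrC -sumA xM0.
have leA's : (#|A'| < s)%N.
  by apply: leq_trans leAs; rewrite [X in (_ < X)%N](cardsD1 i) iA.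
have homM' t l : M' t l \is (d + d).-homog.
  by apply: rpredB; [apply: (dhomogM (homM i j))|apply: (dhomogM (homM t j))].
have xM'0 l : \sum_(t in A') x t * phi (M' t l) = 0.
  have := xM0 l; rewrite sumA => /(congr1 (fun z => phi a * z)).
  rewrite mulrDr mulrA xi mulr0 mulNr mulr_suml mulr_sumr addrC -sumrB => sum0.
  rewrite -[RHS]sum0.
  by apply: eq_bigr => t _; rewrite rmorphB !rmorphM /=; ring.
(* If [x] vanished on [A'], equation [j] would give [phi a * x i = 0], hence [x i = 0] as well. *)
have xN0 : exists2 t, t \in A' & x t != 0.
  have [i0i|ni0i] := eqVneq i0 i; last by exists i0; rewrite // !inE ni0i.
  apply/exists_inP; apply: contraNT xi0 => /exists_inPn x0.
  rewrite i0i -(mulrI_eq0 (x i) (lregP a0)) xi oppr_eq0.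
  by rewrite big1 // => t /x0/negbNE/eqP->; rewrite mul0r.
have [e [g [homg [i1 i1A' gi1] gM']]] := IH _ _ _ _ leA's homM' xM'0 xN0.
have ii1 : (i1 == i) = false by move: i1A'; rewrite !inE; case: eqP.
(* Back substitution: equation [j] determines the entry at [i], and scaling the other entries by [a]
   clears its denominator. *)
exists (d + e)%N, (fun t => if t == i then - \sum_(t in A') M t j * g t
                            else a * g t); split.
- move=> t; case: ifP => _; last exact: (dhomogM (homM i j)).
  by rewrite rpredN; apply: rpred_sum => u _; apply: dhomogM.
- exists i1; first by move: i1A'; rewrite !inE => /andP[].
  by rewrite ii1 rmorphM mulf_neq0.
move=> l; rewrite -[RHS](gM' l) sumA eqxx.
rewrite rmorphN rmorph_sum mulNr mulr_suml addrC.
rewrite -sumrB; apply: eq_bigr => t; rewrite !inE => /andP[/negPf-> _].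
by rewrite rmorphB !rmorphM /=; ring.
Qed.

End Elimination.

(** * Independence of elements taken along a chain of primes *)

Section PrimeChains.
Variables (k : fieldType) (A : comNzRingType) (c : {rmorphism k -> A}).

Lemma idealr_sum (P : {pred A}) (I : Type) (r : seq I) (Q : pred I) F :
  idealr_closed P -> (forall i, Q i -> F i \in P) ->
  \sum_(i <- r | Q i) F i \in P.
Proof.
case=> P0 _ PD FP; elim/big_rec: _ => // i x Qi xP.
by rewrite -[F i]mul1r PD // FP.
Qed.

Lemma idealrMl (P : {pred A}) a u : idealr_closed P -> u \in P -> a * u \in P.
Proof. by case=> P0 _ PD uP; rewrite -[a * u]addr0 PD. Qed.

Lemma idealrBr (P : {pred A}) u v :
  idealr_closed P -> u + v \in P -> v \in P -> u \in P.
Proof.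
by case=> P0 _ PD uvP vP; rewrite -[u](addrK v) addrC -mulN1r PD.
Qed.

Lemma prime_idealrX (P : {pred A}) h a :
  idealr_closed P -> prime_idealr_closed P -> h \notin P -> h ^+ a \notin P.
Proof.
case=> _ P1 _ prP hP; elim: a => [//|a IH]; rewrite exprS.
by apply/negP => /prP; rewrite (negPf hP) (negPf IH).
Qed.

(* The monomials are indexed by I, with exponents E. Those of lowest exponent
   in h 0 form a combination that lies in P 1 after division by a power
   of h 0. *)
Lemma prime_chain_independent (I : finType) r (P : nat -> {pred A})
    (h : nat -> A) (E : I -> nat -> nat) (b : I -> k) (S : {set I}) :
  (forall i, (i <= r)%N -> idealr_closed (P i)) ->
  (forall i, (i < r)%N -> prime_idealr_closed (P i)) ->
  (forall i, (i < r)%N -> {subset P i <= P i.+1}) ->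
  (forall i, (i < r)%N -> h i \in P i.+1 /\ h i \notin P i) ->
  {in S &, forall x y, (forall i, (i < r)%N -> E x i = E y i) -> x = y} ->
  {in S, forall x, b x != 0} -> S != set0 ->
  \sum_(x in S) c (b x) * \prod_(i < r) h i ^+ E x i \notin P 0%N.
Proof.
elim: r P h E S => [|r IH] P h E S idlP prP subP hP injE bN0 /set0Pn[x0 x0S].
  (* Without exponents to compare, [injE] makes [S] a singleton; its term is a nonzero constant,
     which no proper ideal contains. *)
  have -> : S = [set x0].
    apply/setP => y; rewrite !inE; apply/idP/eqP => [yS|-> //].
    by apply: injE.
  rewrite big_set1 big_ord0 mulr1; have [_ P1 _] := idlP 0%N isT.
  apply: contra P1 => bP.
  have := idealrMl (c (b x0)^-1) (idlP 0%N isT) bP.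
  by rewrite -rmorphM mulVf ?rmorph1 // bN0.
have [x1 x1S minx1] := arg_minnP (E^~ 0%N) x0S.
have {}x1S : x1 \in S := x1S.
set a := E x1 0%N in minx1.
pose S' := [set x in S | E x 0%N == a].
have [h1 h0] := hP 0%N isT.
(* The chain is shifted by one. On [S'] the exponent of [h 0] is constantly [a], so the remaining
   exponents still separate the monomials. *)
have := IH (fun i => P i.+1) (fun i => h i.+1) (fun x i => E x i.+1) S'.
move=> /(_ (fun i => idlP i.+1) (fun i => prP i.+1) (fun i => subP i.+1)).
move=> /(_ (fun i => hP i.+1)) IH'.
pose T x := c (b x) * \prod_(i < r) h i.+1 ^+ E x i.+1.
have {IH'} : \sum_(x in S') T x \notin P 1%N.
  apply: IH'.
  - move=> x y; rewrite !inE => /andP[xS /eqP xa] /andP[yS /eqP ya] eqE.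
    by apply: injE => // -[|i] ?; [rewrite xa ya|apply: eqE].
  - by move=> x; rewrite inE => /andP[/bN0].
  - by apply/set0Pn; exists x1; rewrite inE x1S eqxx.
apply: contra => sumP.
(* The other terms after division by [h 0 ^+ a]: each keeps a factor [h 0], so [V] lies in [P 1].
   Primeness of [P 0] justifies the division. *)
set V := \sum_(x in S | x \notin S') T x * h 0%N ^+ (E x 0%N - a).
have : \sum_(x in S') T x + V \in P 0%N.
  have : h 0%N ^+ a * (\sum_(x in S') T x + V) \in P 0%N.
    suff -> : h 0%N ^+ a * (\sum_(x in S') T x + V) =
       \sum_(x in S) c (b x) * \prod_(i < r.+1) h i ^+ E x i by [].
    rewrite mulrDr [RHS](bigID (mem S')) /= !mulr_sumr; congr (_ + _).
      apply: eq_big => [x|x]; rewrite !inE; first by rewrite andbA andbb.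
      by case/andP => xS /eqP xa; rewrite big_ord_recl /= xa /T; ring.
    apply: eq_bigr => x /andP[xS _]; rewrite big_ord_recl /= /T.
    by rewrite -[X in _ = _ * (_ ^+ X * _)](subnKC (minx1 _ xS)) exprD; ring.
  by move/(prP 0%N isT)/orP => [|//];
     rewrite (negPf (prime_idealrX a (idlP 0%N isT) (prP 0%N isT) h0)).
move/(subP 0%N isT)/(idealrBr (idlP 1%N isT)); apply.
apply: idealr_sum => [|x /andP[xS]]; first exact: idlP.
rewrite inE xS /= => nea.
have /prednK <- : (0 < E x 0 - a)%N.
  by rewrite subn_gt0 ltn_neqAle eq_sym nea minx1.
by rewrite exprSr mulrA; apply: idealrMl => //; apply: idlP.
Qed.

End PrimeChains.

(** * Linear dependence of forms by counting monomials *)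

Lemma linear_dependence (k : fieldType) (T M : finType) (F : T -> M -> k) :
  (#|M| < #|T|)%N ->
  exists2 b : T -> k, exists x, b x != 0 & forall y, \sum_x b x * F x y = 0.
Proof.
move=> ltMT.
pose A : 'M[k]_(#|T|, #|M|) := \matrix_(i, j) F (enum_val i) (enum_val j).
have kerN0 : kermx A != 0.
  rewrite -mxrank_eq0 mxrank_ker subn_eq0 -ltnNge.
  by rewrite (leq_ltn_trans (rank_leq_col A)).
pose v := nz_row (kermx A).
have vA : v *m A = 0 by apply/sub_kermxP; apply: nz_row_sub.
exists (fun x => v 0 (enum_rank x)) => [|y].
  have /rV0Pn[i vi] : v != 0 by rewrite nz_row_eq0.
  by exists (enum_val i); rewrite enum_valK.
have := congr1 (fun B : 'rV_ _ => B 0 (enum_rank y)) vA.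
rewrite !mxE => {2}<-; rewrite (reindex (@enum_val T T)) /=; last first.
  by apply: onW_bij; apply: enum_val_bij.
by apply: eq_bigr => i _; rewrite mxE !enum_valK !enum_rankK.
Qed.

Section HomogeneousDependence.
Variables (k : fieldType) (n : nat).

(* A monomial of degree e is determined by its exponents at the last n
   variables. *)
Lemma homog_eq0 e (G : {mpoly k[n.+1]}) :
  G \is e.-homog ->
  (forall y : {ffun 'I_n -> 'I_e.+1},
     G@_[multinom oapp (fun j => y j : nat) (e - \sum_j y j)%N (unlift ord0 i)
          | i < n.+1] = 0) ->
  G = 0.
Proof.
move=> homG G0; apply/mpolyP => mo; rewrite mcoeff0.
have [/eqP moe|] := boolP (mdeg mo == e); last exact: dhomog_nemf_coeff.
have leme i : (mo i <= e)%N by rewrite -moe mdegE (bigD1 i) //= leq_addr.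
(* Every exponent of [mo] is at most [e], so [inord] does not alter it. *)
rewrite -[RHS](G0 [ffun j => inord (mo (lift ord0 j))]); congr (_@__).
apply/mnmP => i; rewrite mnmE; case: unliftP => [j|] -> /=.
  by rewrite ffunE inordK ?ltnS.
rewrite (eq_bigr (fun j => mo (lift ord0 j))) => [|j _]; last first.
  by rewrite ffunE inordK ?ltnS.
by rewrite -moe mdegE big_ord_recl addnK.
Qed.

(** At most [e.+1 ^ n] monomials have degree [e], so the coefficient vectors of a larger family are
    dependent. *)
Lemma homog_dependence e (T : finType) (F : T -> {mpoly k[n.+1]}) :
  (forall x, F x \is e.-homog) -> (e.+1 ^ n < #|T|)%N ->
  exists2 b : T -> k, exists x, b x != 0 & \sum_x b x *: F x = 0.
Proof.
move=> homF ltT.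
pose mon (y : {ffun 'I_n -> 'I_e.+1}) : 'X_{1..n.+1} :=
  [multinom oapp (fun j => y j : nat) (e - \sum_j y j)%N (unlift ord0 i)
     | i < n.+1].
have ltT' : (#|{ffun 'I_n -> 'I_e.+1}| < #|T|)%N by rewrite card_ffun !card_ord.
have [b bN0 b0] := linear_dependence (fun x y => (F x)@_(mon y)) ltT'.
exists b => //; apply: (@homog_eq0 e) => [|y].
  by apply: rpred_sum => x _; apply: rpredZ; apply: homF.
rewrite raddf_sum -[RHS](b0 y); apply: eq_bigr => x _.
exact: mcoeffZ.
Qed.

End HomogeneousDependence.

(** * From the dimension of the image to algebraic relations *)

Section AlgebraicRelations.
Variables (k : fieldType) (m : nat).
Local Notation A := {mpoly k[m.+1]}.

Lemma notin_homog_component (P : {pred A}) p :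
  idealr_closed P -> p \notin P -> exists e, pihomog mdeg e p \notin P.
Proof.
move=> idlP pP.
have [/forallP compP|/forallPn[e eP]] :=
    boolP [forall e : 'I_(msize p), pihomog mdeg e p \in P].
  case/negP: pP; rewrite (pihomog_partitionE (leqnn (msize p))).
  by apply: idealr_sum => // e _; apply: compP.
by exists e.
Qed.

(** A nonzero constant term would be a unit in [P]. Hence every proper homogeneous ideal lies in the
    irrelevant ideal, which can be put on top of a chain. *)
Lemma homog_ideal_coef0 (P : {pred A}) p :
  idealr_closed P -> homogeneous_ideal P -> p \in P -> p@_0%MM = 0.
Proof.
move=> idlP homP /(homP _ 0%N) pP; apply: contraTeq isT => p0.
have [_ P1 _] := idlP; case/negP: P1.
have := idealrMl (p@_0%MM)^-1%:MP idlP pP; rewrite pihomogE.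
rewrite (eq_bigl (pred1 0%MM)) => [|mo]; last exact: mdeg_eq0.
rewrite big_mkcond (bigD1_seq 0%MM) ?msupp_uniq ?mcoeff_msupp //= eqxx.
rewrite big1 => [|mo /negPf-> //].
by rewrite addr0 mpolyX0 mul_mpolyC scalerA mulVf ?scale1r.
Qed.

Lemma pihomog0_coef0 (p : A) : p@_0%MM = 0 -> pihomog mdeg 0 p = 0.
Proof.
move=> p0; rewrite pihomogE big1 // => mo; rewrite mdeg_eq0 => /eqP->.
by rewrite p0 scale0r.
Qed.

(** Each of the [n + 1] strict inclusions of the completed chain supplies a form, and suitable
    powers bring these forms to one degree [D]. *)
Lemma Proj_chain_independent (I : {pred A}) n (Q : nat -> {pred A}) :
  Proj_chain I n Q ->
  exists (D : nat) (h : nat -> A),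
    (forall i, (i <= n)%N -> h i \is D.-homog) /\
    forall (T : finType) (E : T -> nat -> nat) (b : T -> k),
      (forall x y, (forall i, (i <= n)%N -> E x i = E y i) -> x = y) ->
      (exists x, b x != 0) ->
      \sum_x b x *: \prod_(i < n.+1) h i ^+ E x i \notin Q 0%N.
Proof.
move=> [ptQ incQ].
(* Completing the chain by the irrelevant ideal makes its length n + 1. *)
pose P i : {pred A} := if (i <= n)%N then Q i else [pred p : A | p@_0%MM == 0].
have PE i : (i <= n)%N -> P i = Q i by rewrite /P => ->.
have PS : P n.+1 = [pred p : A | p@_0%MM == 0] by rewrite /P ltnn.
have idlP i : (i <= n.+1)%N -> idealr_closed (P i).
  rewrite leq_eqVlt => /predU1P[->|]; last first.
    by rewrite ltnS => lin; rewrite PE //; case: (ptQ i lin).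
  rewrite PS; split; rewrite ?inE ?mcoeff0 ?eqxx ?mcoeff1 ?eqxx ?oner_eq0 //.
  move=> a u v; rewrite !inE => /eqP u0 /eqP v0.
  by rewrite mcoeffD v0 addr0 rmorphM /= u0 mulr0.
have prP i : (i < n.+1)%N -> prime_idealr_closed (P i).
  by rewrite ltnS => lin; rewrite PE //; case: (ptQ i lin).
have subP i : (i < n.+1)%N -> {subset P i <= P i.+1}.
  rewrite ltnS leq_eqVlt => /predU1P[->|lin]; last first.
    by rewrite !PE // 1?ltnW //; case: (incQ i lin).
  move=> p; rewrite PS PE // => pQ; rewrite inE.
  case: (ptQ n (leqnn n)) => idlQ _ homQ _ _.
  exact/eqP/(homog_ideal_coef0 idlQ homQ).
have newP i : (i < n.+1)%N -> exists2 p, p \in P i.+1 & p \notin P i.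
  rewrite ltnS leq_eqVlt => /predU1P[->|lin]; last first.
    by rewrite !PE // 1?ltnW //; case: (incQ i lin).
  case: (ptQ n (leqnn n)) => _ _ _ _ [j jQ]; exists 'X_j; last by rewrite PE.
  by rewrite PS inE mcoeffX -mdeg_eq0 mdeg1.
have homP i : (i <= n.+1)%N -> homogeneous_ideal (P i).
  rewrite leq_eqVlt => /predU1P[->|]; last first.
    by rewrite ltnS => lin; rewrite PE //; case: (ptQ i lin).
  rewrite PS => p e; rewrite !inE => /eqP p0.
  have [->|e0] := eqVneq e 0%N; last first.
    have mdeg0e : mdeg (0%MM : 'X_{1..m.+1}) != e by rewrite mdeg0 eq_sym.
    exact/eqP/(dhomog_nemf_coeff (pihomogP mdeg e p) mdeg0e).
  by rewrite pihomog0_coef0 ?mcoeff0.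
(* A new element can be replaced by one of its homogeneous components. Its degree is positive
   because elements of [P i.+1] have no constant term. *)
have newhP (i : 'I_n.+1) : exists w : nat * A,
    [/\ w.2 \is w.1.-homog, (0 < w.1)%N, w.2 \in P i.+1 & w.2 \notin P i].
  have [p pP pNP] := newP i (ltn_ord i).
  have [e eNP] := notin_homog_component (idlP i (ltnW (ltn_ord i))) pNP.
  have eP : pihomog mdeg e p \in P i.+1 by apply: homP.
  exists (e, pihomog mdeg e p); split=> //=; first exact: pihomogP.
  rewrite lt0n; apply: contraNneq eNP => e0.
  rewrite e0 pihomog0_coef0; first by case: (idlP i (ltnW (ltn_ord i))).
  exact: homog_ideal_coef0 (idlP i.+1 (ltn_ord i)) (homP _ (ltn_ord i)) pP.
have [w wP] := fin_all_exists newhP.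
(* A common multiple of the degrees. Powers with positive exponents stay inside [P i.+1] as well as
   outside the prime [P i]. *)
pose D := (\prod_(i < n.+1) (w i).1)%N.
have Ddiv i : ((w i).1 %| D)%N by rewrite /D (bigD1 i) //= dvdn_mulr.
have D0 : (0 < D)%N by apply: prodn_gt0 => i; case: (wP i).
pose h i := (w (inord i)).2 ^+ (D %/ (w (inord i)).1).
exists D, h; split=> [i lin|T E b injE [x0 bx0]].
  rewrite -(divnK (Ddiv (inord i))) mulnC; apply: dhomogMn.
  by case: (wP (inord i)).
rewrite (bigID (fun x => b x == 0)) big1 /= => [|x /eqP->]; last exact: scale0r.
rewrite add0r -PE //; pose S := [set x | b x != 0].
rewrite (eq_bigl (fun x => x \in S)) => [|x]; last by rewrite inE.
rewrite (eq_bigr (fun x => (b x)%:MP * \prod_(i < n.+1) h i ^+ E x i));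
  last by move=> x _; rewrite mul_mpolyC.
apply: (prime_chain_independent (@mpolyC m.+1 k)
          idlP prP subP) => [i lin|x y _ _|x|].
- case: (wP (inord i)) => _ w0; rewrite inordK // => wP1 wP0; split; last first.
    by apply: prime_idealrX wP0; [apply: idlP; apply: ltnW|apply: prP].
  rewrite /h; have /prednK <- : (0 < D %/ (w (inord i)).1)%N.
    by rewrite divn_gt0 // dvdn_leq.
  by rewrite exprSr; apply: idealrMl wP1; apply: idlP.
- exact: injE.
- by rewrite inE.
- by apply/set0Pn; exists x0; rewrite inE.
Qed.

(** A homogeneous equation for [X_i / X_l] over the degree 0 part of k(f). The products of a
    monomial in the independent forms and a monomial in [X_i], [X_l] outnumber the monomials of
    their degree. *)
Lemma image_dim_relation n d (f : (m.+1).-tuple {mpoly k[n.+1]})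
    (i l : 'I_n.+1) :
  (forall j, tnth f j \is d.-homog) -> image_dim_eq f n ->
  exists (e J : nat) (a : nat -> A),
    [/\ forall j, a j \is e.-homog, a 0%N \mPo f != 0 &
        \sum_(0 <= j < J.+1) (a j \mPo f) * ('X_i ^+ j * 'X_l ^+ (J - j)) = 0].
Proof.
move=> homf [[Q chQ] _].
have [D [h [homh indh]]] := Proj_chain_independent chQ.
have subQ : {subset image_ideal f <= Q 0%N} by case: chQ => /(_ 0%N isT) [].
(* There are [N ^ n * N] products, whose degree plus one is [(d * (D * n) + 1) * N]; so at most
   [N' * N ^ n] monomials occur, and [N' < N] suffices. *)
pose N' := ((d * (D * n) + 1) ^ n)%N; pose N := N'.+1.
(* The exponent at 0 completes the total to [n * N]; the subtraction is exact since each [x j] is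
   below [N]. *)
pose E (x : {ffun 'I_n -> 'I_N}) (t : nat) : nat :=
  if t is s.+1 then oapp (fun j => x j : nat) 0%N (insub s)
  else (n * N - \sum_j x j)%N.
have ES x (j : 'I_n) : E x j.+1 = x j by rewrite /= valK.
have sumE x : (\sum_(t < n.+1) E x t = n * N)%N.
  rewrite big_ord_recl (eq_bigr (fun j => x j : nat)) => [|j _]; last exact: ES.
  rewrite /= subnK // -[n in (n * N)%N]card_ord -sum_nat_const.
  by apply: leq_sum => j _; apply: ltnW.
have injE x y : (forall t, (t <= n)%N -> E x t = E y t) -> x = y.
  move=> Exy; apply/ffunP => j; apply: val_inj.
  by rewrite /= -!ES Exy.
pose H x := \prod_(t < n.+1) h t ^+ E x t.
have homH x : H x \is (D * (n * N)).-homog.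
  rewrite -(sumE x); apply: homog_prod_const => t; apply: homh.
  by rewrite -ltnS.
pose F (z : {ffun 'I_n -> 'I_N} * 'I_N) : {mpoly k[n.+1]} :=
  (H z.1 \mPo f) * ('X_i ^+ z.2 * 'X_l ^+ (N' - z.2)).
have homX (t : 'I_n.+1) s : ('X_t ^+ s : {mpoly k[n.+1]}) \is s.-homog.
  have X1 : ('X_t : {mpoly k[n.+1]}) \is 1.-homog by rewrite dhomogX /= mdeg1.
  by have := dhomogMn s X1; rewrite mul1n.
have homF z : F z \is (d * (D * (n * N)) + N').-homog.
  apply: dhomogM; first exact: comp_mpoly_homog.
  have := dhomogM (homX i z.2) (homX l (N' - z.2)%N).
  by rewrite subnKC // -ltnS.
have ltT :
    ((d * (D * (n * N)) + N').+1 ^ n < #|{: {ffun 'I_n -> 'I_N} * 'I_N}|)%N.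
  rewrite card_prod card_ffun !card_ord.
  have -> : ((d * (D * (n * N)) + N').+1 = (d * (D * n) + 1) * N)%N by lia.
  by rewrite expnMn mulnC ltn_pmul2l ?expn_gt0.
have [b [[x0 j0] bN0] b0] := homog_dependence homF ltT.
pose a (j : nat) := \sum_x b (x, inord j) *: H x.
have homa j : a j \is (D * (n * N)).-homog.
  by apply: rpred_sum => x _; apply: rpredZ; apply: homH.
have relN : \sum_(0 <= j < N) (a j \mPo f) * ('X_i ^+ j * 'X_l ^+ (N' - j)) = 0.
  transitivity (\sum_x \sum_j b (x, j) *: F (x, j)); last first.
    by rewrite pair_bigA -[RHS]b0; apply: eq_bigr => -[].
  rewrite big_mkord exchange_big /=; apply: eq_bigr => j _.
  rewrite raddf_sum mulr_suml; apply: eq_bigr => x _.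
  by rewrite inord_val /F /= comp_mpolyZ scalerAl.
(* Independence modulo [Q 0], which contains the image ideal, keeps [a j0] from vanishing at [f]. *)
have : exists j, (j < N)%N && (a j \mPo f != 0).
  exists j0; rewrite ltn_ord /=; apply/negP => aj0.
  have /negP := indh _ E (fun x => b (x, j0)) injE (ex_intro _ x0 bN0).
  by apply; have := subQ (a j0); rewrite inE aj0 /a inord_val; apply.
(* Dividing by ['X_i ^+ j1] for the least such index makes the coefficient at 0 nonzero. *)
case/ex_minnP => j1 /andP[j1N aj1] minj1.
exists (D * (n * N))%N, (N' - j1)%N, (fun j => a (j1 + j)%N).
split=> //; first by rewrite addn0.
have XN0 : 'X_i ^+ j1 != 0 :> {mpoly k[n.+1]}.
  by rewrite expf_neq0 // -msupp_eq0 msuppX.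
apply: (mulfI XN0); rewrite mulr0 -[RHS]relN.
rewrite [RHS](big_cat_nat _ (n := j1)) //=; last exact: ltnW.
rewrite [X in _ = X + _]big_nat [X in _ = X + _]big1;
    last first.
  move=> j /andP[_ ltj].
  have [->|aj] := eqVneq (a j \mPo f) 0; first by rewrite mul0r.
  by have := minj1 j; rewrite aj (ltn_trans ltj j1N) leqNgt ltj => /(_ isT).
rewrite add0r [RHS](big_addn 0 N j1) mulr_sumr /N subSn //.
apply: eq_big_nat => j _; rewrite [(j + j1)%N]addnC exprD subnDA; ring.
Qed.

End AlgebraicRelations.

(** * Kernels in corank one, and roots of affine polynomials *)

Lemma corank1_kernel (K : fieldType) m q (A : 'M[K]_(m.+1, q))
    (u z : 'rV[K]_m.+1) :
  \rank A = m -> u != 0 -> u *m A = 0 -> z *m A = 0 -> exists c, z = c *: u.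
Proof.
move=> rkA u0 uA zA; apply/sub_rVP.
have uker : (u <= kermx A)%MS by apply/sub_kermxP.
have : (u == kermx A)%MS.
  by rewrite -(mxrank_leqif_eq uker).2 mxrank_ker rkA subSnn rank_rV u0.
by case/andP=> _; apply: submx_trans; apply/sub_kermxP.
Qed.

(** In the lowest degree where some [z i] has a coefficient, the relation involves only those
    coefficients and the constant terms of [N]. This specializes a kernel vector to t = 0 without
    losing it. *)
Lemma lowest_coef_kernel (D : comNzRingType) (I J : finType)
    (z : I -> {poly D}) (N : I -> J -> {poly D}) :
  (forall l, \sum_i z i * N i l = 0) -> (exists i, z i != 0) ->
  exists z0 : I -> D,
    [/\ exists i, z0 i != 0, forall i, z i = 0 -> z0 i = 0
      & forall l, \sum_i z0 i * (N i l)`_0 = 0].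
Proof.
move=> zN [i zi].
have exs : exists s, [exists i, (z i)`_s != 0].
  exists (size (z i)).-1; apply/existsP; exists i.
  by rewrite -[_`_ _]/(lead_coef (z i)) lead_coef_eq0.
case: (ex_minnP exs) => s /existsP nzs mins.
exists (fun i => (z i)`_s); split=> // [j ->|l]; first by rewrite coef0.
have := congr1 (fun p : {poly D} => p`_s) (zN l).
rewrite coef_sum coef0 => sum0.
rewrite -[RHS]sum0; apply: eq_bigr => j _.
rewrite coefM big_ord_recr /= subnn big1 ?add0r // => t _.
have [->|zt] := eqVneq (z j)`_t 0; first by rewrite mul0r.
have : (s <= t)%N by apply: mins; apply/existsP; exists j.
by rewrite leqNgt ltn_ord.
Qed.

(** Over the fraction field [z] is a multiple of [u], and the entry at [j0] forces the factor to be
    0. *)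
Lemma frac_corank1_kernel (D : idomainType) m q (M : 'M[D]_(m.+1, q))
    (u z : 'I_m.+1 -> D) j0 :
  \rank (map_mx (@FracField.tofrac D) M) = m -> u j0 != 0 -> z j0 = 0 ->
  (forall l, \sum_j u j * M j l = 0) -> (forall l, \sum_j z j * M j l = 0) ->
  forall j, z j = 0.
Proof.
move=> rkM u0 z0 uM zM j.
pose vec (v : 'I_m.+1 -> D) := \row_j FracField.tofrac (v j).
have vecM v : (forall l, \sum_j v j * M j l = 0) ->
    vec v *m map_mx (@FracField.tofrac D) M = 0.
  move=> vM; apply/rowP => l; rewrite !mxE.
  have := congr1 (@FracField.tofrac D) (vM l).
  rewrite rmorph_sum tofrac0 => sum0; rewrite -[RHS]sum0; apply: eq_bigr => i _.
  by rewrite !mxE rmorphM.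
have vu0 : vec u != 0.
  by apply/rV0Pn; exists j0; rewrite mxE tofrac_eq0.
have [c zcu] := corank1_kernel rkM vu0 (vecM _ uM) (vecM _ zM).
have zc i : FracField.tofrac (z i) = c * FracField.tofrac (u i).
  by have := congr1 (fun B : 'rV_ _ => B 0 i) zcu; rewrite !mxE.
have /eqP := zc j0.
rewrite z0 tofrac0 eq_sym mulf_eq0 tofrac_eq0 (negPf u0) orbF.
by move/eqP=> c0; apply/eqP; rewrite -tofrac_eq0 zc c0 mul0r.
Qed.

(** At the root t = -x/u of x + t u only the term [j = 0] survives, and [a 0 != 0] makes y + t v
    vanish there too. *)
Lemma affine_root_proportional (D : idomainType) J (a : nat -> D)
    (x y u v : D) :
  a 0%N != 0 -> u != 0 ->
  \sum_(0 <= j < J.+1) (a j)%:P *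
     ((x%:P + 'X * u%:P) ^+ j * (y%:P + 'X * v%:P) ^+ (J - j)) = 0 ->
  u * y = v * x.
Proof.
move=> a0 u0 rel; pose T := @FracField.tofrac D.
have Tu0 : T u != 0 by rewrite tofrac_eq0.
have := congr1 (fun p => (map_poly T p).[- (T x / T u)]) rel.
rewrite rmorph0 horner0 rmorph_sum horner_sum big_ltn // big_nat.
have root0 : T x + - (T x / T u) * T u = 0 by rewrite mulNr divfK ?subrr.
rewrite big1 => [|[//|j] _]; last first.
  rewrite !(rmorphM, rmorphXn, rmorphD) /= !map_polyC map_polyX !hornerE.
  by rewrite /= root0 expr0n mulr0 mul0r.
rewrite addr0 !(rmorphM, rmorphXn, rmorphD) /= !map_polyC map_polyX !hornerE /=.
move/eqP; rewrite mulr1 mulf_eq0 tofrac_eq0 (negPf a0) /= expf_eq0.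
case/andP=> _ /eqP yv; apply/eqP; rewrite -tofrac_eq !tofracM; apply/eqP.
move: yv; rewrite mulNr => /subr0_eq ->.
by rewrite mulrA [_ * (_ / _)]mulrC divfK // mulrC.
Qed.

(** * The substitution of X + t w for X, with the polynomial variable as t *)

Section Perturbation.
Variables (k : fieldType) (n : nat).
Local Notation R := {mpoly k[n.+1]}.
Local Notation c := (polyC \o @mpolyC n.+1 k).
Variable w : 'I_n.+1 -> R.

Local Notation sigma := (mmap c (fun i => ('X_i)%:P + 'X * (w i)%:P)).

Lemma perturbation_coef0 (p : R) : (sigma p)`_0 = p.
Proof.
rewrite -horner_coef0 [in RHS](mpolyE p) /mmap horner_sum.
apply: eq_bigr => mo _; rewrite hornerM hornerC mul_mpolyC -mmap1_id.
congr (_ *: _); rewrite /mmap1 horner_prod; apply: eq_bigr => i _.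
by rewrite horner_exp !hornerE.
Qed.

Lemma mmap_polyC m (f : m.-tuple R) (G : {mpoly k[m]}) :
  mmap c (fun j => (tnth f j)%:P) G = (G \mPo f)%:P.
Proof.
rewrite comp_mpolyE raddf_sum; apply: eq_bigr => mo _ /=.
rewrite -mul_mpolyC polyCM rmorph_prod /=; congr (_ * _).
by apply: eq_bigr => j _; rewrite rmorphXn.
Qed.

End Perturbation.

(** * Birationality from linear syzygies of maximal rank *)

Lemma linear_syzygies_birational (k : fieldType) n m d q
    (f : (m.+1).-tuple {mpoly k[n.+1]}) (M : 'M[{mpoly k[n.+1]}]_(m.+1, q)) :
  (forall j, tnth f j \is d.-homog) -> (exists j, tnth f j != 0) ->
  (forall j l, M j l \is 1.-homog) ->
  (forall l, \sum_j tnth f j * M j l = 0) ->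
  frac_rank M = m -> image_dim_eq f n -> birational_onto_image f.
Proof.
move=> homf [j0 fj0] homM fM rkM dimf.
(* B is the Jacobian dual of M: (Y_0, ..., Y_m) M = (X_0, ..., X_n) B. *)
pose B i l : {mpoly k[m.+1]} := \sum_j (M j l)@_U_(i) *: 'X_j.
have homB i l : B i l \is 1.-homog.
  by apply: rpred_sum => j _; apply: rpredZ; rewrite dhomogX /= mdeg1.
have BfE i l : B i l \mPo f = \sum_j (M j l)@_U_(i) *: tnth f j.
  rewrite raddf_sum; apply: eq_bigr => j _ /=.
  by rewrite comp_mpolyZ comp_mpolyXU -tnth_nth.
have XB l : \sum_(i in [set: 'I_n.+1]) 'X_i * (B i l \mPo f) = 0.
  rewrite -[RHS](fM l) (eq_bigl xpredT) => [|i]; last by rewrite inE.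
  rewrite (eq_bigr (fun i => \sum_j (M j l)@_U_(i) *: ('X_i * tnth f j))).
    rewrite exchange_big /=; apply: eq_bigr => j _.
    rewrite [in RHS](homog1E (homM j l)) mulr_sumr; apply: eq_bigr => i _.
    by rewrite -scalerAr mulrC.
  by move=> i _; rewrite BfE mulr_sumr; apply: eq_bigr => j _; rewrite scalerAr.
have XN0 (i : 'I_n.+1) : 'X_i != 0 :> {mpoly k[n.+1]}.
  by rewrite -msupp_eq0 msuppX.
have XN0T : exists2 i : 'I_n.+1,
    i \in [set: 'I_n.+1] & 'X_i != 0 :> {mpoly k[n.+1]}.
  by exists ord0; rewrite ?inE ?XN0.
(* The tuple of variables is a nonzero kernel vector of B(f); elimination replaces it by one whose
   entries are values of forms at [f]. *)
have [e [g [homg [i1 _ gi1] gB]]] := homog_left_kernel homB XB XN0T.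
pose w i := g i \mPo f.
pose c : {rmorphism k -> {poly {mpoly k[n.+1]}}} := polyC \o @mpolyC n.+1 k.
pose y (i : 'I_n.+1) := ('X_i)%:P + 'X * (w i)%:P.
pose s (p : {mpoly k[n.+1]}) := mmap c y p.
(* By duality the sum is column [l] of (X + t w) B(f), and both X and w kill B(f). *)
have fsM l : \sum_j (tnth f j)%:P * s (M j l) = 0.
  transitivity (\sum_i y i * (B i l \mPo f)%:P).
    rewrite (eq_bigr (fun j =>
      \sum_i c (M j l)@_U_(i) * (y i * (tnth f j)%:P))).
      rewrite exchange_big /=; apply: eq_bigr => i _.
      rewrite BfE rmorph_sum mulr_sumr; apply: eq_bigr => j _ /=.
      by rewrite -mul_mpolyC polyCM mulrCA.
    move=> j _; rewrite [M j l in LHS](homog1E (homM j l)) /s raddf_sum.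
    rewrite mulr_sumr; apply: eq_bigr => i _.
    by rewrite /= mmapZ mmapX mmap1U /=; ring.
  rewrite /y (eq_bigr (fun i => ('X_i * (B i l \mPo f))%:P
                              + 'X * (w i * (B i l \mPo f))%:P)).
    rewrite big_split /= -mulr_sumr -!rmorph_sum.
    have := XB l; rewrite (eq_bigl xpredT) => [->|i]; last by rewrite inE.
    have := gB l; rewrite (eq_bigl xpredT) => [/= ->|i]; last by rewrite inE.
    by rewrite polyC0 mulr0 addr0.
  by move=> i _; rewrite !polyCM; ring.
have sfM l : \sum_j s (tnth f j) * s (M j l) = 0.
  have := congr1 s (fM l); rewrite /s raddf_sum mmap0 => sum0.
  by rewrite -[RHS]sum0; apply: eq_bigr => j _; rewrite /= rmorphM.
have sf j : (tnth f j0)%:P * s (tnth f j) = s (tnth f j0) * (tnth f j)%:P.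
  (* This kernel vector of M(X + t w) vanishes at [j0]. If it were nonzero, its lowest coefficients
     would form a nonzero kernel vector of [M] vanishing at [j0], against corank one. *)
  pose z j := (tnth f j0)%:P * s (tnth f j) - s (tnth f j0) * (tnth f j)%:P.
  apply/eqP; rewrite -subr_eq0 -/(z j); apply: contraTT isT => zj.
  have zM l : \sum_j z j * s (M j l) = 0.
    rewrite (eq_bigr (fun j => (tnth f j0)%:P * (s (tnth f j) * s (M j l))
                       - s (tnth f j0) * ((tnth f j)%:P * s (M j l)))).
      by rewrite sumrB -!mulr_sumr sfM fsM !mulr0 subr0.
    by move=> i _; rewrite /z mulrBl !mulrA.
  have [z0 [[i z0i] zz0 z0M]] := lowest_coef_kernel zM (ex_intro _ j zj).
  have z0j0 : z0 j0 = 0 by apply: zz0; rewrite /z mulrC subrr.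
  have {}z0M l : \sum_j z0 j * M j l = 0.
    rewrite -[RHS](z0M l); apply: eq_bigr => t _.
    by rewrite /s perturbation_coef0.
  have := frac_corank1_kernel (u := tnth f) rkM fj0 z0j0 fM z0M i.
  by move/eqP; rewrite (negPf z0i).
(* The factor between G(f) before and after the substitution depends only on the degree of [G]. *)
have sG G t : G \is t.-homog ->
    (tnth f j0)%:P ^+ t * s (G \mPo f) = s (tnth f j0) ^+ t * (G \mPo f)%:P.
  move=> homG; rewrite /s mmap_comp_mpoly -mmap_homogZ // -mmap_polyC.
  by rewrite -mmap_homogZ //; apply: eq_mmap => j; apply: sf.
have prop l : w i1 * 'X_l = w l * 'X_i1.
  have [t [J [a [homa a0 rel]]]] := image_dim_relation i1 l homf dimf.
  apply: (affine_root_proportional (J := J) (a := fun j => a j \mPo f)) => //.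
  have sfj0 : s (tnth f j0) != 0.
    apply: contraNneq fj0 => sf0.
    have : (s (tnth f j0))`_0 = tnth f j0 by apply: perturbation_coef0.
    by rewrite sf0 coef0 => <-.
  (* All [a j] have degree [t], so after substitution [s (tnth f j0) ^+ t] factors out and the
     coefficients a_j(f) become constant in t. *)
  have := congr1 (fun p => (tnth f j0)%:P ^+ t * s p) rel.
  rewrite /s raddf_sum mmap0 mulr0 mulr_sumr => rel'.
  apply: (mulfI (expf_neq0 t sfj0)); rewrite mulr0 mulr_sumr -[RHS]rel'.
  apply: eq_bigr => j _.
  rewrite /= rmorphM [RHS]mulrA -/(s (a j \mPo f)) sG // -mulrA.
  by congr (_ * (_ * _)); rewrite rmorphM !rmorphXn /= !mmapX !mmap1U.
exists e, g; split=> //; first by exists i1.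
exists (FracField.tofrac (w i1) / FracField.tofrac 'X_i1) => l.
rewrite mulrAC -tofracM prop tofracM mulfK // tofrac_eq0; exact: XN0.
Qed.

Theorem theorem2p2 (k : fieldType) (n m d : nat)
    (f : (m.+1).-tuple {mpoly k[n.+1]})
    (p : nat) (phi : 'M[{mpoly k[n.+1]}]_(m.+1, p))
    (q : nat) (phi1 : 'M[{mpoly k[n.+1]}]_(m.+1, q))
    (d_ge1 : (1 <= d)%N)
    (f_homog : forall j : 'I_m.+1, tnth f j \is d.-homog)
    (f_neq0 : exists j : 'I_m.+1, tnth f j != 0)
    (phi_syz : graded_syzygy_matrix f phi)
    (phi1_lin : linear_part phi phi1)
    (dim_image : image_dim_eq f n)
    (rank_phi1 : frac_rank phi1 = m) :
  birational_onto_image f.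
Proof.
(* Taking a unit vector for the constants in [linear_part] shows that each column of [phi1] is
   itself a linear syzygy. *)
have phi1E l : col l phi1 = phi1 *m map_mx (@mpolyC n.+1 k) (delta_mx l 0).
  rewrite colE; congr (_ *m _); apply/matrixP => i j.
  by rewrite !mxE mpolyC_nat.
have phi1P l : (exists u, col l phi1 = phi *m u)
    /\ (forall j, col l phi1 j 0 \is 1.-homog).
  by apply/phi1_lin; exists (delta_mx l 0).
apply: (linear_syzygies_birational (d := d) (M := phi1)) => // [j l|l].
  by have [_ /(_ j)] := phi1P l; rewrite mxE.
have [/phi_syz.2 syz _] := phi1P l.
by rewrite -[RHS]syz; apply: eq_bigr => j _; rewrite mxE.
Qed.
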